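(* Consider a parallel network of $n$ roads with $m$ vehicle types and affine latencies $c_i(z_i)=\sum_{j\in[m]}a_i^jz_i^j+b_i$, and assume the latency of each road is strictly increasing in the flow of each vehicle type, i.e. $a_i^j>0$ for all $i\in[n]$, $j\in[m]$. Let $z^*$ be any socially optimal routing whose associated bipartite graph $G(z^* )$ is acyclic. For $\mu\in\mathbb R$, $\epsilon>0$ and $P\in\mathbb R$, levy the tolls $$\tau_i^j=\begin{cases}\mu-c_i(z_i^* ) & \text{if } i\in\mathcal N_j^{z^*},\\ \mu-c_i(z_i^* )+\epsilon & \text{if } i\in\big(\bigcup_{j'\in[m]}\mathcal N_{j'}^{z^*}\big)\setminus\mathcal N_j^{z^*},\\ P & \text{otherwise.}\end{cases}$$ Then for every $\mu$, every $\epsilon>0$, and all sufficiently large $P$, the only equilibrium (Wardrop Equilibrium under these tolls) that exists is the flow $z^*$.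
   Context: Parallel network: $n$ parallel roads $i\in[n]=\{1,\dots,n\}$ from a common source to a common destination; $m$ vehicle types $j\in[m]$ with fixed demands $\beta_j\ge0$. A feasible routing is $z=(z_i^j)$ with $z_i^j\ge0$ (flow of type $j$ on road $i$) and $\sum_{i\in[n]}z_i^j=\beta_j$ for each $j$. Write $z_i=(z_i^1,\dots,z_i^m)$. Latency on road $i$ (same for all types): $c_i(z_i)=\sum_{j}a_i^jz_i^j+b_i$ with $b_i\ge0$. Social cost (tolls not counted): $C(z)=\sum_{i\in[n]}\big(\sum_{j\in[m]}z_i^j\big)c_i(z_i)$; a socially optimal routing minimizes $C$ over feasible routings. $\mathcal N_j^{z}=\{i\in[n]: z_i^j>0\}$ is the set of roads carrying positive flow of type $j$ under $z$. $G(z)$ is the bipartite graph whose two node classes are the roads $[n]$ and the vehicle types $[m]$, with an edge between road $i$ and type $j$ iff $z_i^j>0$. Under tolls $\tau$, a user of type $j$ on road $i$ has cost $c_i(z_i)+\tau_i^j$. A feasible $z$ is a Wardrop Equilibrium if $z_i^j>0$ implies $c_i(z_i)+\tau_i^j\le c_{i'}(z_{i'})+\tau_{i'}^j$ for all $i,i'\in[n]$, $j\in[m]$. *)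

(* Defs.v *)
From HB Require Import structures.
From mathcomp Require Import all_boot all_order all_algebra.
From mathcomp Require Import reals.
Set Implicit Arguments.
Unset Strict Implicit.
Unset Printing Implicit Defensive.
Import Order.TTheory GRing.Theory Num.Theory.
Local Open Scope ring_scope.

(* A routing z is an n x m matrix: z i j is the flow of vehicle type j : 'I_m
   on road i : 'I_n. *)

Definition feasible (R : realType) (n m : nat) (beta : 'I_m -> R)
    (z : 'M[R]_(n, m)) : Prop :=
  (forall i j, 0 <= z i j) /\ (forall j, \sum_(i < n) z i j = beta j).

Definition latency (R : realType) (n m : nat) (a : 'M[R]_(n, m))
    (b : 'I_n -> R) (z : 'M[R]_(n, m)) (i : 'I_n) : R :=
  \sum_(j < m) a i j * z i j + b i.

Definition social_cost (R : realType) (n m : nat) (a : 'M[R]_(n, m))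
    (b : 'I_n -> R) (z : 'M[R]_(n, m)) : R :=
  \sum_(i < n) (\sum_(j < m) z i j) * latency a b z i.

Definition socially_optimal (R : realType) (n m : nat) (a : 'M[R]_(n, m))
    (b : 'I_n -> R) (beta : 'I_m -> R) (z : 'M[R]_(n, m)) : Prop :=
  feasible beta z /\
  (forall y, feasible beta y -> social_cost a b z <= social_cost a b y).

Definition used_roads (R : realType) (n m : nat) (z : 'M[R]_(n, m))
    (j : 'I_m) : {set 'I_n} :=
  [set i | 0 < z i j].

Definition routing_graph (R : realType) (n m : nat) (z : 'M[R]_(n, m)) :
    rel ('I_n + 'I_m) :=
  fun u v => match u, v with
             | inl i, inr j | inr j, inl i => 0 < z i j
             | _, _ => false
             end.

(* For a symmetric irreflexive e.  Closed walks of length 2 (an edge traversed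
   back and forth) satisfy ucycleb, hence the bound on the size. *)
Definition acyclic (T : eqType) (e : rel T) : Prop :=
  forall p : seq T, (2 < size p)%N -> ~~ ucycleb e p.

Definition wardrop (R : realType) (n m : nat) (a : 'M[R]_(n, m))
    (b : 'I_n -> R) (beta : 'I_m -> R) (tau : 'M[R]_(n, m))
    (z : 'M[R]_(n, m)) : Prop :=
  feasible beta z /\
  (forall (i i' : 'I_n) (j : 'I_m), 0 < z i j ->
     latency a b z i + tau i j <= latency a b z i' + tau i' j).

Definition tolls (R : realType) (n m : nat) (a : 'M[R]_(n, m))
    (b : 'I_n -> R) (zs : 'M[R]_(n, m)) (mu eps P : R) : 'M[R]_(n, m) :=
  \matrix_(i, j)
    if i \in used_roads zs j then mu - latency a b zs i
    else if i \in (\bigcup_(j' < m) used_roads zs j') :\: used_roads zs j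
    then mu - latency a b zs i + eps
    else P.

(* Main.v *)
(** Write [d = z - zs] and [D i = \sum_j a i j * d i j], the change of latency
    on road [i].  For large [P] an equilibrium [z] leaves the roads unused by
    [zs] empty, so if type [j] moved onto [i] and away from [i'], then
    [D i <= D i'], strictly when [zs] has no [j] on [i].  Hence on the roads
    where [D] is maximal, each edge with [d > 0] lies in the forest [G(zs)] and
    is followed, at the type, by an edge with [d < 0] leading to another such
    road; if the maximum is nonnegative, that road has in turn an edge with
    [d > 0], since [a > 0].  A walk of alternating signs never backtracks, so
    in a finite forest it cannot go on forever: hence [d = 0] on these roads.
    The roads where [D] is minimal are treated in the same way with signs
    exchanged, so [D = 0]; then all roads are extremal, and [d = 0]
    everywhere. *)
Require Import Defs.
From HB Require Import structures.
From mathcomp Require Import all_boot all_order all_algebra.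
From mathcomp Require Import reals.
From mathcomp Require Import lra.
Set Implicit Arguments.
Unset Strict Implicit.
Unset Printing Implicit Defensive.
Import Order.TTheory GRing.Theory Num.Theory.
Local Open Scope ring_scope.

(** A non-backtracking walk that meets itself closes a cycle of length at least 3; one that never
    does outgrows the finite type. *)
Lemma acyclic_no_endless_walk (T : finType) (e q : rel T) :
  acyclic e -> irreflexive e -> subrel q e ->
  (forall u v, q u v -> exists2 w, w != u & q v w) ->
  forall u v, ~~ q u v.
Proof.
move=> ac irr qe next u v; apply/negP=> quv.
(* Walks are listed newest vertex first, so they grow at the head along the converse of [q]. *)
pose q' x y := q y x.
have q_irr x : ~~ q x x by apply/negP=> /qe; rewrite irr.
have long k : exists x y p,
    [/\ uniq [:: x, y & p], path q' x (y :: p) & size p = k].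
  elim: k => [|k [x [y [p [Up Pp <-]]]]].
    exists v, u, [::]; split=> //=; last by rewrite /q' quv.
    by rewrite inE andbT; apply: contraTneq quv => ->; apply: q_irr.
  have /andP[qyx _] := Pp.
  have [w wy qxw] := next _ _ qyx.
  have wx : w != x by apply: contraTneq qxw => ->; apply: q_irr.
  have [wp|wp] := boolP (w \in p); last first.
    exists w, x, (y :: p); split=> //; last by rewrite /= /q' qxw.
    by rewrite cons_uniq Up !inE !negb_or wx wy wp.
  (* Here [w] is an old vertex other than [x] and [y], so the stretch between [w] and [x] closes
     into a cycle. *)
  case/splitPr: wp Up Pp => p1 p2.
  rewrite -cat_rcons -!cat_cons cat_uniq cat_path => /andP[Uc _] /andP[Pc _].
  pose c := [:: x, y & rcons p1 w].
  have size_c : (2 < size (rev c))%N by rewrite size_rev /= size_rcons.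
  have /negP[] := ac (rev c) size_c.
  rewrite /ucycleb rev_uniq Uc andbT.
  apply: (sub_cycle qe); rewrite rev_cycle.
  by rewrite (cycle_path x) /= last_rcons /q' qxw.
have [x [y [p [Up _ sp]]]] := long #|T|.
have := max_card [in [:: x, y & p]].
by rewrite (card_uniqP Up) /= sp ltnNge leqnSn.
Qed.

Lemma psumr_gt0_exists (R : realDomainType) (I : finType) (F : I -> R) :
  0 < \sum_i F i -> exists i, 0 < F i.
Proof.
move=> Fgt0; apply/existsP; apply: contraTT Fgt0 => /existsPn F0.
by rewrite -leNgt; apply: sumr_le0 => i _; rewrite leNgt F0.
Qed.

Lemma sumr_ge0_lt0_exists (R : realDomainType) (I : finType) (F : I -> R) i0 :
  0 <= \sum_i F i -> F i0 < 0 -> exists i, 0 < F i.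
Proof.
move=> F0 Fi0; have : 0 < \sum_(i | i != i0) F i.
  by move: F0; rewrite (bigD1 i0) //=; lra.
rewrite big_mkcond => /psumr_gt0_exists[i].
by case: ifP => // _; [exists i | rewrite ltxx].
Qed.

(** Neutral in sign, so as to serve for [d] where the latency change is maximal and for [- d] where
    it is minimal. *)
Lemma forest_balance (R : realType) (n m : nat) (a zs d : 'M[R]_(n, m))
    (S : {set 'I_n}) :
  (forall i j, 0 < a i j) -> acyclic (routing_graph zs) ->
  (forall i j, i \in S -> 0 < d i j -> 0 < zs i j /\
     exists i', [/\ i' \in S, d i' j < 0 & 0 < zs i' j]) ->
  (forall i, i \in S -> 0 <= \sum_j a i j * d i j) ->
  forall i j, i \in S -> d i j = 0.
Proof.
move=> a0 ac type_next road_ge0.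
have road_next i j : i \in S -> d i j < 0 -> exists j', 0 < d i j'.
  move=> iS dij.
  have [|j'] := sumr_ge0_lt0_exists (i0 := j) (road_ge0 _ iS).
    by rewrite pmulr_rlt0.
  by rewrite pmulr_rgt0 //; exists j'.
(* The walk leaves a road along [d > 0] and a type along [d < 0]; this change of sign keeps it from
   turning back. *)
pose q (u v : 'I_n + 'I_m) := match u, v with
  | inl i, inr j => (i \in S) && (0 < d i j)
  | inr j, inl i => [&& i \in S, d i j < 0 & 0 < zs i j]
  | _, _ => false end.
have noq : forall u v, ~~ q u v.
  apply: (acyclic_no_endless_walk ac).
  - by case.
  - case=> [i|j] [i'|j'] //=; last by case/and3P.
    by case/andP=> iS /(type_next _ _ iS)[].
  - case=> [i|j] [i'|j'] //=.
      case/andP=> iS dij; have [_ [i2 [i2S di2 zi2]]] := type_next _ _ iS dij.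
      exists (inl i2); last by rewrite /= i2S di2.
      by apply: contraTneq di2 => -[->]; rewrite -leNgt ltW.
    case/and3P=> iS dij _; have [j2 dj2] := road_next _ _ iS dij.
    exists (inr j2); last by rewrite /= iS.
    by apply: contraTneq dj2 => -[->]; rewrite -leNgt ltW.
have no_pos i j : i \in S -> (0 < d i j) = false.
  by move=> iS; apply/negbTE; have := noq (inl i) (inr j); rewrite /= iS.
move=> i j iS; case: (ltgtP (d i j) 0) => // [dij|]; last by rewrite no_pos.
by have [j'] := road_next _ _ iS dij; rewrite no_pos.
Qed.

Section Displacement.

Variables (R : realType) (n m : nat) (a zs d : 'M[R]_(n, m)).
Hypothesis a_gt0 : forall i j, 0 < a i j.
Hypothesis zs_acyclic : acyclic (routing_graph zs).
Hypothesis d_neg : forall i j, d i j < 0 -> 0 < zs i j.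
Hypothesis d_bal : forall j, \sum_i d i j = 0.

Let D i := \sum_j a i j * d i j.

Hypothesis d_move : forall i i' j, 0 < d i j -> d i' j < 0 ->
  D i <= D i' /\ (D i = D i' -> 0 < zs i j).

Let d_pos_neg i j : 0 < d i j -> exists i', d i' j < 0.
Proof.
move=> dij.
have [||i'] := @sumr_ge0_lt0_exists R _ (fun i => - d i j) i.
- by rewrite sumrN d_bal oppr0.
- by rewrite oppr_lt0.
- by rewrite oppr_gt0; exists i'.
Qed.

Let d_neg_pos i j : d i j < 0 -> exists i', 0 < d i' j.
Proof.
by apply: (@sumr_ge0_lt0_exists R _ (fun i => d i j)); rewrite d_bal.
Qed.

Lemma displacement_argmax i0 :
  (forall i, D i <= D i0) -> 0 <= D i0 -> forall j, d i0 j = 0.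
Proof.
move=> Dmax D0 j.
apply: (@forest_balance _ _ _ a zs d [set i | D i == D i0]) => //;
  last by rewrite inE.
- move=> i k; rewrite inE => /eqP Di dik.
  have [i' di'] := d_pos_neg dik.
  have [le_D eq_D] := d_move dik di'.
  have Di' : D i' = D i0 by apply/le_anti; rewrite Dmax -Di.
  split; first by rewrite eq_D // Di.
  by exists i'; rewrite inE Di'; split=> //; apply: d_neg di'.
- by move=> i; rewrite inE => /eqP; rewrite /D => ->.
Qed.

(** For [- d] the two reasons for lying in the forest trade places: [d_neg] covers the edge entering
    a type, the equality case of [d_move] the edge leaving it. *)
Lemma displacement_argmin i0 :
  (forall i, D i0 <= D i) -> D i0 <= 0 -> forall j, d i0 j = 0.
Proof.
move=> Dmin D0 j.
suff /(_ i0 j) : forall i j, i \in [set i | D i == D i0] -> (- d) i j = 0.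
  by rewrite inE eqxx mxE => /(_ isT)/eqP; rewrite oppr_eq0 => /eqP.
apply: (@forest_balance _ _ _ a zs) => //.
- move=> i k; rewrite inE mxE oppr_gt0 => /eqP Di dik.
  split; first exact: d_neg dik.
  have [i' di'] := d_neg_pos dik.
  have [le_D eq_D] := d_move di' dik.
  have Di' : D i' = D i0 by apply/le_anti; rewrite Dmin -Di le_D.
  by exists i'; rewrite inE Di' mxE oppr_lt0; split=> //; rewrite eq_D // Di.
- move=> i; rewrite inE => /eqP Di.
  under eq_bigr do rewrite mxE mulrN.
  by rewrite sumrN oppr_ge0 -/(D i) Di.
Qed.

Lemma displacement_eq0 : d = 0.
Proof.
have D_eq0 i : (forall j, d i j = 0) -> D i = 0.
  by move=> di; rewrite /D big1 // => j _; rewrite di mulr0.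
have D0 i : D i = 0.
  apply/le_anti/andP; split.
  (* A nonnegative maximum forces [d = 0] on its road, hence is itself 0. *)
  - have [k _ Dmax] := @Order.TotalTheory.arg_maxP _ _ _ i xpredT D isT.
    rewrite (le_trans (Dmax i isT)) //; have /orP[//|Dk] := le_total (D k) 0.
    by rewrite D_eq0 // => j; apply: displacement_argmax => // l; apply: Dmax.
  - have [k _ Dmin] := @Order.TotalTheory.arg_minP _ _ _ i xpredT D isT.
    rewrite (le_trans _ (Dmin i isT)) //; have /orP[//|Dk] := le_total 0 (D k).
    by rewrite D_eq0 // => j; apply: displacement_argmin => // l; apply: Dmin.
apply/matrixP=> i j; rewrite mxE.
by apply: displacement_argmax => [l|]; rewrite !D0.
Qed.

End Displacement.

Section Routing.

Variables (R : realType) (n m : nat) (a : 'M[R]_(n, m)) (b : 'I_n -> R).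
Variable beta : 'I_m -> R.
Hypothesis a_gt0 : forall i j, 0 < a i j.
Hypothesis b_ge0 : forall i, 0 <= b i.

Lemma feasible_le (z : 'M[R]_(n, m)) i j : feasible beta z -> z i j <= beta j.
Proof.
by case=> z0 /(_ j)<-; rewrite (bigD1 i) //= lerDl sumr_ge0.
Qed.

Lemma latency_ge0 z i : feasible beta z -> 0 <= latency a b z i.
Proof.
case=> z0 _; rewrite addr_ge0 // sumr_ge0 // => j _.
by rewrite mulr_ge0 // ltW.
Qed.

Lemma latency_le z i : feasible beta z ->
  latency a b z i <= \sum_j a i j * beta j + b i.
Proof.
move=> fz; rewrite lerD2r ler_sum // => j _.
by rewrite ler_wpM2l ?(ltW (a_gt0 _ _)) ?feasible_le.
Qed.

Lemma latencyB (z y : 'M[R]_(n, m)) i :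
  \sum_j a i j * (z - y) i j = latency a b z i - latency a b y i.
Proof.
rewrite /latency opprD addrACA subrr addr0 -sumrB.
by apply: eq_bigr => j _; rewrite !mxE mulrBr.
Qed.

Lemma feasible_used (z y : 'M[R]_(n, m)) i j :
  feasible beta z -> feasible beta y -> 0 < z i j -> exists i', 0 < y i' j.
Proof.
move=> fz [y0 yb] zij; apply: psumr_gt0_exists; rewrite yb.
exact: lt_le_trans zij (feasible_le _ _ fz).
Qed.

End Routing.

Lemma tollsE (R : realType) (n m : nat) (a : 'M[R]_(n, m)) b zs mu eps P i j :
  tolls a b zs mu eps P i j =
    if 0 < zs i j then mu - latency a b zs i
    else if [exists j', 0 < zs i j'] then mu - latency a b zs i + eps else P.
Proof.
rewrite mxE !inE; case: (0 < zs i j) => //=; congr (if _ then _ else _).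
apply/bigcupP/existsP => [[j' _]|[j' zj']]; first by rewrite inE; exists j'.
by exists j'; rewrite ?inE.
Qed.

Theorem theorem5 (R : realType) (n m : nat)
    (a : 'M[R]_(n, m)) (b : 'I_n -> R) (beta : 'I_m -> R)
    (a_gt0 : forall i j, 0 < a i j)
    (b_ge0 : forall i, 0 <= b i)
    (beta_ge0 : forall j, 0 <= beta j)
    (zs : 'M[R]_(n, m))
    (zs_opt : socially_optimal a b beta zs)
    (zs_acyclic : acyclic (routing_graph zs))
    (mu eps : R) (eps_gt0 : 0 < eps) :
  exists P0 : R, forall P : R, P0 <= P ->
    forall z : 'M[R]_(n, m),
      wardrop a b beta (tolls a b zs mu eps P) z <-> z = zs.
Proof.
have [fzs _] := zs_opt.
pose B i := \sum_j a i j * beta j + b i.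
have B_ge0 i : 0 <= B i.
  by apply: le_trans (latency_le b a_gt0 i fzs); apply: latency_ge0 fzs.
(* [B i] bounds the latency of road [i] under every feasible routing; the threshold puts [P]
   strictly above every [B i + mu]. *)
exists (\sum_i B i + `|mu| + 1) => P leP z.
have sumB_ge0 : 0 <= \sum_i B i by apply: sumr_ge0.
have le_mu := ler_norm mu.
have leB i : B i <= \sum_i B i by rewrite (bigD1 i) //= lerDl sumr_ge0.
have P_gt i : B i + mu < P by have := leB i; lra.
split=> [[fz wz]|->]; last first.
  (* Under [zs] a type pays exactly [mu] where it travels and at least [mu] elsewhere. *)
  split=> // i i' j zij; rewrite !tollsE zij.
  have l0 := latency_ge0 a_gt0 b_ge0 i' fzs.
  have := P_gt i'; have := B_ge0 i'.
  by case: ifP => _; [lra|case: ifP => _; lra].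
(* On a road left empty by [zs] type [j] would pay at least [P], but at most [B i' + mu] on a road
   [i'] that it uses under [zs]. *)
have z_used i j : 0 < z i j -> [exists j', 0 < zs i j'].
  move=> zij; apply: contraT => unused.
  have [i' zsi'] := feasible_used fz fzs zij.
  have := wz i i' j zij; rewrite !tollsE zsi' (negbTE unused).
  have -> : (0 < zs i j) = false.
    by apply: contraNF unused => zsij; apply/existsP; exists j.
  have := latency_ge0 a_gt0 b_ge0 i fz; have := latency_le b a_gt0 i' fz.
  have := latency_ge0 a_gt0 b_ge0 i' fzs; have := P_gt i'.
  by rewrite -/(B i'); lra.
have [zs0 zsb] := fzs; have [z0 zb] := fz.
apply/eqP; rewrite -subr_eq0; apply/eqP.
apply: (@displacement_eq0 _ _ _ a zs) => //.
- by move=> i j; rewrite !mxE subr_lt0; apply: le_lt_trans.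
- by move=> j; under eq_bigr do rewrite !mxE; rewrite sumrB zb zsb subrr.
(* Type [j] uses [i] under [z] and [i'] under [zs], so the equilibrium inequality compares the two
   latency changes, with [eps] added on the side of [i] when [zs] has no [j] there: hence
   strictness. *)
move=> i i' j; rewrite !(latencyB a b) !mxE subr_gt0 subr_lt0 => zij zi'j.
have zij0 := le_lt_trans (zs0 i j) zij.
have := wz i i' j zij0; rewrite !tollsE (z_used _ _ zij0).
rewrite (le_lt_trans (z0 i' j) zi'j).
by case: ifP => _ H; split; lra.
Qed.
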